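(* There is an absolute constant $C$ such that the following holds. Let $a_1, a_2, a_3$ be any coprime integers, none of which is zero. Then for every $N$ there is a finite set $S \subseteq \mathbb{Z}$ with $|S| \geq N$ and $$T_{a_1,a_2,a_3}(S) \geq \frac{1}{12}|S|^2 - C|S|.$$ (That is, regardless of the values of $a_1,a_2,a_3$, there are sets $S$ with $|S|$ arbitrarily large for which $T(S) \geq \frac{1}{12}|S|^2 + O(|S|)$.)
   Context: For a finite set $S \subseteq \mathbb{Z}$, $T_{a_1,a_2,a_3}(S)$ denotes the number of triples $(x_1,x_2,x_3) \in S^3$ with $a_1x_1+a_2x_2+a_3x_3=0$. *)

(* Defs.v *)
From HB Require Import structures.
From mathcomp Require Import all_boot all_order all_algebra.
From mathcomp Require Import finmap.
From mathcomp Require Import reals.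

Set Implicit Arguments.
Unset Strict Implicit.
Unset Printing Implicit Defensive.

Import Order.TTheory GRing.Theory Num.Theory.

Local Open Scope fset_scope.
Local Open Scope ring_scope.

Definition solutions (a1 a2 a3 : int) (S : {fset int}) :
    {fset int * int * int} :=
  [fset x in S `*` S `*` S | a1 * x.1.1 + a2 * x.1.2 + a3 * x.2 == 0].

Definition T (a1 a2 a3 : int) (S : {fset int}) : nat :=
  #|` solutions a1 a2 a3 S|.

(* Main.v *)
Require Import Defs.
From HB Require Import structures.
From mathcomp Require Import all_boot all_order all_algebra.
From mathcomp Require Import finmap.
From mathcomp Require Import reals.
From mathcomp Require Import zify ring lra.

(** Rescaling [x1 = a2 a3 y1], [x2 = a1 a3 y2], [x3 = a1 a2 y3] turns the equation
    into [y1 + y2 + y3 = 0].  Let [S] be the union of the three dilates of [[-k, k]]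
    by [a2 a3], [a1 a3], [a1 a2]: it has at most [3 (2 k + 1)] elements, while the
    hexagon [y1 + y2 + y3 = 0], [|yi| <= k] has [3 k (k + 1) + 1] points, and
    [(6 k + 3)^2 / 12 = 3 k (k + 1) + 3 / 4]. *)

Set Implicit Arguments.
Unset Strict Implicit.
Unset Printing Implicit Defensive.

Import Order.TTheory GRing.Theory Num.Theory.

Local Open Scope fset_scope.
Local Open Scope ring_scope.

Definition dilate (b : int) (k : nat) : {fset int} :=
  [fset b * ((u : 'I_k.*2.+1)%:Z - k%:Z) | u in 'I_k.*2.+1].

Lemma mem_dilate (b y : int) (k : nat) : `|y| <= k%:Z -> b * y \in dilate b k.
Proof.
move=> yk.
have uk : (absz (y + k%:Z)%R < k.*2.+1)%N by lia.
apply/imfsetP; exists (Ordinal uk) => //=.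
by congr (_ * _); lia.
Qed.

Lemma card_dilate_le (b : int) (k : nat) : (#|` dilate b k| <= k.*2.+1)%N.
Proof.
apply: (leq_trans (leq_imfset_card _ _ _)) => /=.
by rewrite -cardE card_ord.
Qed.

Lemma card_dilate (b : int) (k : nat) :
  b != 0 -> #|` dilate b k| = k.*2.+1.
Proof.
move=> b0; rewrite card_imfset /=; first by rewrite -cardE card_ord.
by move=> u v /(mulfI b0) uv; apply: val_inj => /=; lia.
Qed.

(* The hexagon minus its centre is the disjoint union of the three rhombi
   [y1 > 0 >= y2], [y2 > 0 >= y3], [y3 > 0 >= y1], indexed by [c]. *)
Definition hexagon (k : nat) (p : 'I_3 * 'I_k * 'I_k.+1) : int * int * int :=
  let: (c, i, j) := p in
  let u : int := i.+1%:Z in let v : int := - j%:Z in let w := - (u + v) in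
  if c == 0 :> nat then (u, v, w) else if c == 1%N :> nat then (w, u, v) else (v, w, u).

(** Any two of the rhombi disagree on the sign of some coordinate, which determines [c]; then [u]
    and [v] give back [i] and [j]. *)
Lemma hexagon_inj (k : nat) : injective (@hexagon k).
Proof.
move=> [[c i] j] [[c' i'] j'] e.
have [ec ei ej] : [/\ c = c' :> nat, i = i' :> nat & j = j' :> nat].
  have := ltn_ord c; have := ltn_ord c'; move: e; rewrite /hexagon.
  by do 4?case: ifP => ?; case; split; lia.
by congr (_, _, _); apply: val_inj.
Qed.

(** As [1 <= u <= k] and [-k <= v <= 0] have opposite signs, [u + v] stays within [[1 - k, k]]. *)
Lemma hexagonP (k : nat) p : let y := @hexagon k p in
  [/\ `|y.1.1| <= k%:Z, `|y.1.2| <= k%:Z, `|y.2| <= k%:Z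
    & y.1.1 + y.1.2 + y.2 = 0].
Proof.
case: p => [[c i] j] /=; have := ltn_ord i; have := ltn_ord j.
by do 2?case: ifP => ?; split => /=; lia.
Qed.

Definition dilates (a1 a2 a3 : int) (k : nat) : {fset int} :=
  dilate (a2 * a3) k `|` dilate (a1 * a3) k `|` dilate (a1 * a2) k.

Lemma card_dilates_le (a1 a2 a3 : int) (k : nat) :
  (#|` dilates a1 a2 a3 k| <= 3 * k.*2.+1)%N.
Proof.
have cardU (A B : {fset int}) : (#|` A `|` B| <= #|` A| + #|` B|)%N.
  by rewrite cardfsU leq_subr.
apply: leq_trans (cardU _ _) _.
rewrite (_ : 3 * _ = k.*2.+1 + k.*2.+1 + k.*2.+1)%N; last by lia.
apply: leq_add; last exact: card_dilate_le.
by apply: leq_trans (cardU _ _) _; apply: leq_add; exact: card_dilate_le.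
Qed.

Lemma T_dilates_ge (a1 a2 a3 : int) (k : nat) :
  a1 != 0 -> a2 != 0 -> a3 != 0 ->
  (3 * k * k.+1 <= T a1 a2 a3 (dilates a1 a2 a3 k))%N.
Proof.
move=> a10 a20 a30.
pose g (y : int * int * int) := (a2 * a3 * y.1.1, a1 * a3 * y.1.2, a1 * a2 * y.2).
have g_inj : injective g.
  move=> [[x1 x2] x3] [[y1 y2] y3] [].
  have [n23 n13 n12] : [/\ a2 * a3 != 0, a1 * a3 != 0 & a1 * a2 != 0].
    by rewrite !mulf_neq0.
  by move=> /(mulfI n23) -> /(mulfI n13) -> /(mulfI n12) ->.
have -> : (3 * k * k.+1 = #|` [fset g (@hexagon k p) | p in {: 'I_3 * 'I_k * 'I_k.+1}]|)%N.
  rewrite card_imfset /=; last exact: inj_comp g_inj (@hexagon_inj k).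
  by rewrite -cardE !card_prod !card_ord.
apply: fsubset_leq_card; apply/fsubsetP => _ /imfsetP [p _ ->] /=.
have /= [y1k y2k y3k y0] := hexagonP p.
rewrite !inE /= !mem_dilate ?orbT //=; apply/eqP.
(* After rescaling, each term [ai * xi] equals [a1 * a2 * a3 * yi]. *)
rewrite -[RHS](mulr0 (a1 * a2 * a3)) -y0; ring.
Qed.

Theorem proposition1p2 (R : realType) :
  exists C : R,
    forall a1 a2 a3 : int,
      gcdz (gcdz a1 a2) a3 = 1 ->
      a1 != 0 -> a2 != 0 -> a3 != 0 ->
      forall N : nat,
        exists S : {fset int},
          (N <= #|` S|)%N /\
          (1 / 12) * (#|` S|)%:R ^+ 2 - C * (#|` S|)%:R
            <= (T a1 a2 a3 S)%:R :> R.
Proof.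
exists 1 => a1 a2 a3 _ a10 a20 a30 N; exists (dilates a1 a2 a3 N).
(* A single dilate already makes [S] large enough, and nonempty for the final estimate. *)
have cardS_ge : (N.*2.+1 <= #|` dilates a1 a2 a3 N|)%N.
  rewrite -(@card_dilate (a1 * a2)) ?mulf_neq0 //.
  by apply: fsubset_leq_card; exact: fsubsetUr.
split; first by lia.
have := card_dilates_le a1 a2 a3 N; have := T_dilates_ge N a10 a20 a30.
move: cardS_ge; move: (#|` _|) (T _ _ _ _) => s t s_ge t_ge s_le.
(* From [s <= 6 * N + 3], [s ^ 2 <= 36 * N * (N + 1) + 9 <= 12 * t + 9], and [s >= 1] lets [12 * s]
   absorb the [9]; hence [C = 1]. *)
have : (s ^ 2 <= 12 * (t + s))%N by nia.
by rewrite -(ler_nat R) natrX natrM natrD; lra.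
Qed.
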